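(* A countable injection structure $\mathcal{A}=(A,f)$ is weakly ultrahomogeneous if and only if it has finitely many $\omega$-orbits. In this case, a minimal exceptional set contains exactly one member from each $\omega$-orbit.
   Context: An injection structure $(A,f)$ is a set $A$ with a single one-to-one unary function $f:A\to A$. The orbits of $f$ partition $A$ into finite cycles, $\omega$-orbits (one-way infinite orbits $\{f^n(a):n\in\omega\}$ with $a$ not in the range of $f$) and $\mathbb{Z}$-orbits (two-way infinite orbits). $\langle\vec{x}\rangle$ denotes the substructure generated by $\vec{x}$, i.e. the closure of $\vec{x}$ under $f$. A finite set $\{a_1,\dots,a_n\}\subseteq A$ is exceptional if for all finite tuples $\vec{x},\vec{y}$ of equal length from $A$, every isomorphism $\langle\vec{a},\vec{x}\rangle\cong\langle\vec{a},\vec{y}\rangle$ with $a_i\mapsto a_i$ and $x_j\mapsto y_j$ extends to an automorphism of $\mathcal{A}$; $\mathcal{A}$ is weakly ultrahomogeneous if it has a (finite) exceptional set. An exceptional set is minimal if no proper subset of it is exceptional. *)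

(* Defs.v *)
From mathcomp Require Import all_boot.
From mathcomp Require Import boolp classical_sets functions cardinality.

Set Implicit Arguments.
Unset Strict Implicit.
Unset Printing Implicit Defensive.

Local Open Scope classical_set_scope.

Section InjectionStructures.
Context {A : Type} (f : A -> A).

Definition omega_orbit (O : set A) : Prop :=
  exists a, ~ range f a /\ O = range (fun n : nat => iter n f a).

Definition closed_under (B : set A) : Prop := forall b, B b -> B (f b).

Definition generated (X : set A) : set A := smallest closed_under X.

(* A map between substructures is represented by a total function on A, whose
   values outside the domain B are irrelevant. *)
Definition isomorphism (B C : set A) (phi : A -> A) : Prop :=
  set_bij B C phi /\ (forall b, B b -> phi (f b) = f (phi b)).

Definition automorphism (sigma : A -> A) : Prop :=
  isomorphism setT setT sigma.

Definition exceptional (S : set A) : Prop :=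
  finite_set S /\
  forall (n : nat) (x y : n.-tuple A) (phi : A -> A),
    let B := generated (S `|` range (tnth x)) in
    let C := generated (S `|` range (tnth y)) in
    isomorphism B C phi ->
    (forall a, S a -> phi a = a) ->
    (forall j, phi (tnth x j) = tnth y j) ->
    exists sigma, automorphism sigma /\ (forall b, B b -> sigma b = phi b).

Definition weakly_ultrahomogeneous : Prop := exists S, exceptional S.

Definition minimal_exceptional (S : set A) : Prop :=
  exceptional S /\ forall T, T `<` S -> ~ exceptional T.

End InjectionStructures.

(* Main.v *)
Require Import Defs.
From mathcomp Require Import all_boot.
From mathcomp Require Import boolp classical_sets functions cardinality.

(** Both halves follow from a single criterion: a finite set [S] is exceptional
if and only if it meets every omega-orbit.

Necessity ([exceptional_meets]): if [S] misses the omega-orbit of a root [a]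
(a point outside the range of [f]), then shifting that orbit by one step and
fixing everything else is an isomorphism from the substructure generated by
[S] and [a] onto the one generated by [S] and [f a]. No automorphism extends
it, because automorphisms preserve the range of [f].

Sufficiency ([meets_exceptional]): let [phi : B -> C] be an isomorphism fixing
[S] pointwise, [B] and [C] being finitely generated. Going backwards along
orbits, [phi] extends to the union of the orbits that meet [B]; the only
obstruction would be a root on one side facing a non-root on the other, and
[S] rules this out since it pins down every omega-orbit
([induced_matchingP]). The result is a partial automorphism [P] between two
finite unions of orbits. It remains to pair the orbits outside its domain with
the orbits outside its codomain. Instead of counting orbits of each
isomorphism type, send a point [z] outside the domain to the start of the
maximal chain [w], ..., [z] of [P] that ends in [z]. Such a chain exists
because all its points but the last lie in the domain, which has
finitely many orbits, and [P] being injective forbids it to revisit an orbit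
([chain_start]); being unchanged in shape by [f], chains give a bijection that
commutes with [f] ([matching_extends]).

Finally, omega-orbits correspond to their roots, so when they are finitely
many the set of roots is a finite set meeting all of them. A minimal
exceptional set cannot contain two points of one omega-orbit, since removing
one of them would keep the criterion satisfied. *)

Local Open Scope classical_set_scope.

(** * Powers of a binary relation *)

Section RelationPowers.
Set Implicit Arguments.
Unset Strict Implicit.
Context {A : Type}.
Implicit Types (P : A -> A -> Prop) (n : nat).

Definition transpose P x y := P y x.

Fixpoint relpow P n x y : Prop :=
  if n is n'.+1 then exists2 z, P x z & relpow P n' z y else x = y.

Lemma relpow_add P m n x y :
  relpow P (m + n) x y <-> exists2 z, relpow P m x z & relpow P n z y.
Proof.
elim: m x => [|m IHm] x /=; first by split=> [|[z <-]//]; exists x.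
split=> [[z Pxz /IHm[t Pzt Pty]]|[t [z Pxz Pzt] Pty]].
  by exists t => //; exists z.
by exists z => //; apply/IHm; exists t.
Qed.

Lemma relpow_transpose P n x y : relpow (transpose P) n x y <-> relpow P n y x.
Proof.
elim: n x y => [|n IHn] x y; first by split.
rewrite -{2}addn1 relpow_add /=; split=> [[z Pzx /IHn Pyz]|[z Pyz [t Pzt <-]]].
  by exists z => //; exists x.
by exists z => //; apply/IHn.
Qed.

Lemma relpow_functional P :
  (forall x y y', P x y -> P x y' -> y = y') ->
  forall n x y y', relpow P n x y -> relpow P n x y' -> y = y'.
Proof.
move=> Pfun; elim=> [|n IHn] x y y' /=; first by move=> <-.
move=> [z Pxz Pzy] [z' Pxz']; rewrite -(Pfun _ _ _ Pxz Pxz').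
exact: IHn Pzy.
Qed.

Lemma relpow_injective P :
  (forall x x' y, P x y -> P x' y -> x = x') ->
  forall n x x' y, relpow P n x y -> relpow P n x' y -> x = x'.
Proof.
move=> Pinj n x x' y /relpow_transpose Pxy /relpow_transpose.
by apply: relpow_functional Pxy => {}y z z'; apply: Pinj.
Qed.

End RelationPowers.

(** * Orbits of an injection *)

Section InjectionStructure.
Set Implicit Arguments.
Unset Strict Implicit.
Context {A : Type} (f : A -> A) (f_inj : injective f).
Implicit Types (S X O B C : set A) (P : A -> A -> Prop).

Lemma iter_inj n : injective (iter n f).
Proof. by elim: n => [|n IHn] x y //= /f_inj /IHn. Qed.

Lemma generatedE X :
  generated f X = [set z | exists2 g, X g & exists n, z = iter n f g].
Proof.
rewrite /generated; apply/seteqP; split=> [z Xz|z [g Xg [n ->]] B [Bf XB]].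
  apply: Xz; split=> [_ [g Xg [n ->]]|g Xg]; first by exists g => //; exists n.+1.
  by exists g => //; exists 0.
by elim: n => [|n IHn] /=; [apply: XB|apply: Bf].
Qed.

(** Comparing forward images makes this symmetric, so that it captures whole
orbits, including the points that come before [w]. *)
Definition same_orbit z w := exists m n, iter m f z = iter n f w.

Lemma same_orbit_sym z w : same_orbit z w -> same_orbit w z.
Proof. by move=> [m [n e]]; exists n, m. Qed.

Lemma same_orbit_trans y x z :
  same_orbit x y -> same_orbit y z -> same_orbit x z.
Proof.
move=> [m [n e]] [p [q e']]; exists (p + m), (n + q).
by rewrite !iterD e -e' -!iterD addnC.
Qed.

Lemma omega_orbitE O s : omega_orbit f O -> O s -> O = same_orbit s.
Proof.
move=> [a [ra ->]] [k _ <-]; apply/seteqP; split=> [_ [n _ <-]|z [m [n]]].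
  by exists n, k; rewrite -!iterD addnC.
(* If [z] came strictly before [a], then [a] would lie in the range of [f]. *)
rewrite -iterD => e; have nmk : (n <= m + k)%N.
  rewrite leqNgt; apply/negP => lt; apply: ra.
  exists (iter (n - (m + k)).-1 f z) => //.
  apply: (@iter_inj (m + k)); rewrite e -iterS prednK ?subn_gt0//.
  by rewrite -iterD subnKC// ltnW.
exists (m + k - n) => //; apply: (@iter_inj n).
by rewrite -iterD subnKC.
Qed.

Lemma root_unique a b :
  ~ range f a -> ~ range f b -> same_orbit a b -> a = b.
Proof.
move=> ra rb [m [n]]; wlog mn : a b m n ra rb / (m <= n)%N.
  by case/orP: (leq_total m n) => le W e; [|symmetry]; apply: W le _ => //; rewrite e.
rewrite -(subnKC mn) iterD => /iter_inj; case: (n - m) => [//|k] e.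
by case: ra; rewrite e; exists (iter k f b).
Qed.

Lemma omega_orbit_f O z : omega_orbit f O -> O (f z) <-> O z.
Proof.
move=> [a [ra ->]]; split=> [[[|n] _ /= e]|[n _ <-]]; last by exists n.+1.
  by case: ra; exists z.
by exists n => //; apply: f_inj.
Qed.

Lemma omega_orbit_iter O n z : omega_orbit f O -> O (iter n f z) <-> O z.
Proof. by move=> Om; elim: n => //= n <-; apply: omega_orbit_f. Qed.

(** * Necessity: exceptional sets meet every omega-orbit *)

Lemma tnth_singleton (a : A) (i : 'I_1) : tnth [tuple a] i = a.
Proof. by case: i => -[|//] lt01; rewrite (tnth_nth a). Qed.

(** If [S] missed [O], shifting [O] by [f] and fixing the other points would
give an isomorphism of finitely generated substructures moving the root of [O]
into the range of [f], which no automorphism can do. *)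
Lemma exceptional_meets S O :
  exceptional f S -> omega_orbit f O -> exists2 s, S s & O s.
Proof.
move=> [_ Sext] Om; apply: contrapT => SO0.
have SO s : S s -> ~ O s by move=> Ss Os; apply: SO0; exists s.
have [a [ra Oa]] := Om.
have Oar n : O (iter n f a) by rewrite Oa; exists n.
pose phi z := if `[< O z >] then f z else z.
have phiO z : O z -> phi z = f z by rewrite /phi => /asboolP ->.
have phiN z : ~ O z -> phi z = z by rewrite /phi => /asboolPn /negbTE ->.
have [] // := Sext 1 [tuple a] [tuple f a] phi.
- rewrite !generatedE; split; last first.
    move=> b _; have Ofb := omega_orbit_f b Om.
    have [Ob|Ob] := pselect (O b); first by rewrite !phiO// Ofb.
    by rewrite !phiN// Ofb.
  split.
  + move=> _ [g [Sg|[i _ <-]] [n ->]].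
      rewrite phiN; first by exists g; [left|exists n].
      by rewrite omega_orbit_iter//; apply: SO.
    rewrite tnth_singleton phiO//; exists (f a); last by exists n; rewrite -iterSr.
    by right; exists ord0.
  + move=> z w _ _; have := omega_orbit_f z Om; have := omega_orbit_f w Om.
    have [Oz|Oz] := pselect (O z); have [Ow|Ow] := pselect (O w);
      rewrite ?(phiO _ Oz) ?(phiO _ Ow) ?(phiN _ Oz) ?(phiN _ Ow)//.
    * by move=> _ _ /f_inj.
    * by move=> _ Ofz e; case: Ow; rewrite -e Ofz.
    * by move=> Ofw _ e; case: Oz; rewrite e Ofw.
  + move=> _ [g [Sg|[i _ <-]] [n ->]].
      exists (iter n f g); first by exists g; [left|exists n].
      by rewrite phiN// omega_orbit_iter//; apply: SO.
    rewrite tnth_singleton; exists (iter n f a); last by rewrite phiO// -iterSr.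
    by exists a; [right; exists ord0|exists n].
- by move=> s /SO /phiN.
- by move=> j; rewrite !tnth_singleton phiO//; apply: (Oar 0).
move=> sigma [[[_ sigma_inj sigma_surj] sigmaf] sigmaB].
have sfa : sigma a = f a.
  rewrite sigmaB ?phiO//; first exact: (Oar 0).
  by rewrite generatedE; exists a; [right; exists ord0|exists 0].
(* [sigma] maps both [f b] and [a] to [f a], so [a] is in the range of [f]. *)
have [b _ sb] := sigma_surj a I.
apply: ra; exists b => //; apply: (sigma_inj _ _ (in_setT _) (in_setT _)).
by rewrite sigmaf// sb sfa.
Qed.

(** * Extending a partial automorphism with finitely many orbits *)

(** The graph of a partial automorphism whose domain and codomain are unions
of orbits. Using a relation makes the notion self-dual, so that every
statement about the domain transposes to the codomain. The last two fields
only forbid roots to be matched with non-roots; together with [matchingf] they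
make the domain and the codomain closed under preimages by [f]. *)
Record orbit_matching P : Prop := OrbitMatching {
  matching_fun : forall z w w', P z w -> P z w' -> w = w';
  matching_inj : forall z z' w, P z w -> P z' w -> z = z';
  matchingf : forall z w, P z w <-> P (f z) (f w);
  matching_range : forall z w, P (f z) w -> exists w', w = f w';
  matching_domain : forall z w, P z (f w) -> exists z', z = f z' }.

Lemma matching_transpose P : orbit_matching P -> orbit_matching (transpose P).
Proof.
case=> Pfun Pinj Pf Pr Pd; split=> [z w w'|z z' w|z w|z w|z w].
- exact: Pinj.
- exact: Pfun.
- exact: Pf.
- exact: Pd.
- exact: Pr.
Qed.

Lemma matching_dom P n z : orbit_matching P ->
  (exists w, P (iter n f z) w) -> exists w, P z w.
Proof.
move=> Pm; elim: n => //= n IHn [w Pw]; apply: IHn.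
have [w' ew] := matching_range Pm Pw; exists w'.
by apply/(matchingf Pm); rewrite -ew.
Qed.

Lemma relpowf P n z w : orbit_matching P ->
  relpow P n z w -> relpow P n (f z) (f w).
Proof.
move=> Pm; elim: n z => [|n IHn] z /=; first by move=> ->.
by move=> [y Pzy /IHn Pyw]; exists (f y) => //; apply: (matchingf Pm _ _).1.
Qed.

Lemma relpow_iter P n m z w : orbit_matching P ->
  relpow P n z w -> relpow P n (iter m f z) (iter m f w).
Proof. by move=> Pm Pzw; elim: m => //= m; apply: relpowf. Qed.

Definition finitely_many_orbits X :=
  exists2 G : set A, finite_set G & forall z, X z -> exists2 g, G g & same_orbit z g.

(** A backward chain starting from [z] that never leaves the codomain would be
an infinite sequence in the domain of [P]. By the pigeonhole principle two of
its points lie in one orbit; cancelling the shorter part of the chain then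
puts a point of the orbit of [z], hence [z] itself, in the domain. *)
Lemma chain_start P z : orbit_matching P ->
  finitely_many_orbits [set z | exists w, P z w] ->
  ~ (exists w, P z w) ->
  exists n w, relpow P n w z /\ ~ (exists y, P y w).
Proof.
move=> Pm [G Gfin PG] Nz; apply: contrapT => /forallNP noend.
have /choice[u Pu] : forall n, exists w, relpow P n w z.
  elim=> [|n [w Pwz]]; first by exists z.
  apply: contrapT => /forallNP Nw; apply: (noend n); exists w; split=> // -[y Pyw].
  by apply: (Nw y); exists w.
have /choice[g Pg] : forall n, exists g, G g /\ same_orbit (u n.+1) g.
  move=> n; have [|g Gg ug] := PG (u n.+1); last by exists g.
  by have [w Pw _] := Pu n.+1; exists w.
apply: infinite_nat; apply: (@sub_finite_set _ _ (g @^-1` G)).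
  by move=> n _; have [] := Pg n.
apply: finite_preimage => // i j _ _ gij.
wlog ij : i j gij / (i < j)%N.
  by move=> W; case: (ltngtP i j) => // lt; [|symmetry]; apply: W.
have [m [n e]] : same_orbit (u i.+1) (u j.+1).
  apply: same_orbit_trans (Pg i).2 _; rewrite gij.
  exact: same_orbit_sym (Pg j).2.
have /(relpow_iter n Pm) := Pu j.+1; rewrite -e.
(* The number of further steps is written as a successor to expose the first
   of them, which witnesses that [y] is in the domain. *)
have -> : j.+1 = i.+1 + (j - i).-1.+1.
  by rewrite prednK ?subn_gt0// addSn subnKC// ltnW.
move=> /relpow_add[y Py [w Pyw _]].
have ey : y = iter m f z.
  apply: relpow_functional Py _; first exact: matching_fun Pm.
  exact: relpow_iter (Pu i.+1).
by case: Nz; apply: (@matching_dom P m z Pm); exists w; rewrite -ey.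
Qed.

(** A point [z] outside the domain goes to the start [w] of the maximal chain
of [P] leading to it; [w = z] when [z] is also outside the codomain. *)
Definition extension P z w :=
  P z w \/ [/\ ~ (exists y, P z y), ~ (exists y, P y w)
              & exists n, relpow P n w z].

Lemma extension_transpose P z w :
  extension (transpose P) w z <-> extension P z w.
Proof.
by split=> -[Pzw|[Nz Nw [n Pn]]]; [left| |left|] => //; right; split=> //;
  exists n; apply/relpow_transpose.
Qed.

Lemma extension_fun P z w w' : orbit_matching P ->
  extension P z w -> extension P z w' -> w = w'.
Proof.
move=> Pm [Pzw|[Nz Nw [n Pn]]] [Pzw'|[Nz' Nw' [n' Pn']]].
- exact (matching_fun Pm Pzw Pzw').
- by case: Nz'; exists w.
- by case: Nz; exists w'.
(* Two chains ending in [z] share their last steps, and the shorter one starts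
   outside the codomain, so the longer one cannot go further back. *)
wlog le : n n' w w' Nw Nw' Pn Pn' / (n <= n')%N.
  by case/orP: (leq_total n n') => le W; [|symmetry]; apply: W le.
move: Pn'; rewrite -(subnK le) => /relpow_add[y + Py].
rewrite (relpow_injective (matching_inj Pm) Py Pn) {y Py}.
case: (n' - n) => [//|k]; rewrite -addn1 => /relpow_add[y _ [t Pyt et]].
by case: Nw; exists y; rewrite -et.
Qed.

Lemma extension_total P z : orbit_matching P ->
  finitely_many_orbits [set z | exists w, P z w] ->
  exists w, extension P z w.
Proof.
move=> Pm Pfin; have [[w Pzw]|Nz] := pselect (exists w, P z w).
  by exists w; left.
have [n [w [Pn Nw]]] := chain_start Pm Pfin Nz.
by exists w; right; split=> //; exists n.
Qed.

Lemma extensionf P z w : orbit_matching P ->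
  extension P z w -> extension P (f z) (f w).
Proof.
move=> Pm [/(matchingf Pm _ _).1|[Nz Nw [n Pn]]]; first by left.
right; split.
- by move=> [y Py]; apply: Nz; apply: (matching_dom (n := 1) Pm); exists y.
- move=> [y Py]; apply: Nw.
  by apply: (matching_dom (n := 1) (matching_transpose Pm)); exists y.
- by exists n; apply: relpowf.
Qed.

(** [extension P] is functional, total and compatible with [f]. Since it
commutes with transposition, it is also injective and surjective. *)
Lemma matching_extends P : orbit_matching P ->
  finitely_many_orbits [set z | exists w, P z w] ->
  finitely_many_orbits [set w | exists z, P z w] ->
  exists sigma, automorphism f sigma /\ forall z w, P z w -> sigma z = w.
Proof.
move=> Pm dom_fin cod_fin; have Ptm := matching_transpose Pm.
have [sigma sigmaP] := choice (fun z => extension_total z Pm dom_fin).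
exists sigma; split; last first.
  by move=> z w Pzw; apply: extension_fun Pm (sigmaP z) _; left.
split; last by move=> z _; apply: extension_fun Pm (sigmaP _) (extensionf Pm (sigmaP z)).
split=> // [z z' _ _ e|w _].
  apply: (@extension_fun (transpose P) (sigma z) _ _ Ptm).
    exact/extension_transpose.
  by rewrite e; apply/extension_transpose.
have [z /extension_transpose zw] := extension_total w Ptm cod_fin.
by exists z => //; apply: extension_fun Pm (sigmaP z) zw.
Qed.

(** * Sufficiency: meeting every omega-orbit *)

Lemma isomorphism_iter B C phi n z : closed_under f B -> isomorphism f B C phi ->
  B z -> B (iter n f z) /\ phi (iter n f z) = iter n f (phi z).
Proof.
move=> Bf [_ phif] Bz; elim: n => //= n [Bn e].
by split; [apply: Bf|rewrite phif// e].
Qed.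

Lemma generated_closed X : closed_under f (generated f X).
Proof. by move=> b Xb B XB; case: (XB) => Bf _; apply: Bf; apply: Xb. Qed.

Lemma root_omega_orbit a : ~ range f a ->
  omega_orbit f (range (fun n => iter n f a)).
Proof. by exists a. Qed.

(** The extension of [phi] to all points that eventually enter [B]: the image
of [z] is the result of going back [n] steps from the image of [iter n f z]. *)
Definition induced_matching B phi z w :=
  exists2 n, B (iter n f z) & phi (iter n f z) = iter n f w.

(** The point is that roots are not matched with non-roots. A root has an
iterate in [S], where [phi] is the identity; comparing with it shows that a
root can only be matched with itself. *)
Lemma induced_matchingP B C phi S :
  closed_under f B -> isomorphism f B C phi -> S `<=` B ->
  (forall s, S s -> phi s = s) ->
  (forall O, omega_orbit f O -> exists2 s, S s & O s) ->
  orbit_matching (induced_matching B phi).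
Proof.
move=> Bf iso SB phiS Smeets; have [[phiBC phi_inj _] phif] := iso.
(* Any larger number of steps witnesses the same matching. *)
have raise k n z w : B (iter n f z) -> phi (iter n f z) = iter n f w ->
    B (iter (k + n) f z) /\ phi (iter (k + n) f z) = iter (k + n) f w.
  move=> Bz e; rewrite !iterD -e.
  exact: isomorphism_iter Bf iso Bz.
have meets a : ~ range f a -> exists k, S (iter k f a).
  by move=> /root_omega_orbit/Smeets[s Ss [k _ e]]; exists k; rewrite e.
have phiSn n s : S s -> B (iter n f s) /\ phi (iter n f s) = iter n f s.
  by move=> Ss; rewrite -{3}(phiS s Ss); apply: isomorphism_iter Bf iso (SB s Ss).
have phi_injB x y : B x -> B y -> phi x = phi y -> x = y.
  by move=> Bx By; apply: phi_inj; rewrite inE.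
split.
- move=> z w w' [n Bn en] [m Bm em]; apply: (@iter_inj (m + n)).
  have [_ <-] := raise m _ _ _ Bn en.
  by have [_] := raise n _ _ _ Bm em; rewrite addnC.
- move=> z z' w [n Bn en] [m Bm em]; apply: (@iter_inj (m + n)).
  have [B1 e1] := raise m _ _ _ Bn en.
  have := raise n _ _ _ Bm em; rewrite addnC => -[B2 e2].
  by apply: phi_injB => //; rewrite e1 e2.
- move=> z w; split=> [[n Bn en]|[n]]; last by rewrite -!iterSr; exists n.+1.
  have [B1 e1] := raise 1 _ _ _ Bn en.
  by exists n; rewrite -!iterSr.
- move=> z w [n Bn en]; apply: contrapT => Nw.
  have [|k Sk] := meets w; first by case=> w' _ e; apply: Nw; exists w'.
  have [B1 e1] := raise k _ _ _ Bn en.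
  have [B2 e2] := phiSn n _ Sk.
  apply: Nw; exists z; apply/esym/(@iter_inj (k + n))/phi_injB => //.
    by rewrite addnC iterD.
  by rewrite e1 addnC iterD e2.
- move=> z w [n Bn en]; apply: contrapT => Nz.
  have [|k Sk] := meets z; first by case=> z' _ e; apply: Nz; exists z'.
  have [B1 e1] := raise k _ _ _ Bn en.
  have [B2 e2] := phiSn n _ Sk.
  apply: Nz; exists w; apply: (@iter_inj (k + n)).
  by rewrite -e1 addnC iterD e2.
Qed.

Lemma generated_finitely_many_orbits X (P : A -> Prop) : finite_set X ->
  (forall z, P z -> exists n, generated f X (iter n f z)) ->
  finitely_many_orbits P.
Proof.
move=> Xfin PX; exists X => // z /PX[n]; rewrite generatedE => -[g Xg [m e]].
by exists g => //; exists n, m.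
Qed.

(** The isomorphism induces an orbit matching, whose domain and codomain have
finitely many orbits because both substructures are finitely generated. *)
Lemma meets_exceptional S : finite_set S ->
  (forall O, omega_orbit f O -> exists2 s, S s & O s) -> exceptional f S.
Proof.
move=> Sfin Smeets; split=> // n x y phi B C iso phiS _.
have Bf : closed_under f B by apply: generated_closed.
have SB : S `<=` B by apply: subset_trans (@sub_gen_smallest _ _ _); apply: subsetUl.
have Xfin (t : n.-tuple A) : finite_set (S `|` range (tnth t)).
  by rewrite finite_setU; split=> //; apply: finite_image.
have Pm := induced_matchingP Bf iso SB phiS Smeets.
have [||sigma [sigma_aut sigmaP]] := matching_extends Pm.
- by apply: (generated_finitely_many_orbits (Xfin x)) => z [w [k Bk _]]; exists k.
- apply: (generated_finitely_many_orbits (Xfin y)) => w [z [k Bk e]].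
  by exists k; rewrite -e; case: iso => -[+ _ _] _; apply.
by exists sigma; split=> // b Bb; apply: sigmaP; exists 0.
Qed.

End InjectionStructure.

Theorem proposition5p2 (A : Type) (f : A -> A)
    (A_countable : countable [set: A]) (f_inj : injective f) :
  (weakly_ultrahomogeneous f <-> finite_set [set O | omega_orbit f O]) /\
  (weakly_ultrahomogeneous f ->
   forall S : set A, minimal_exceptional f S ->
   forall O : set A, omega_orbit f O -> exists! a, S a /\ O a).
Proof.
split; first split=> [[S Sext]|Ofin].
- apply: sub_finite_set (finite_image (same_orbit f) Sext.1) => O Om.
  have [s Ss Os] := exceptional_meets f_inj Sext Om.
  by exists s => //; rewrite (omega_orbitE f_inj Om Os).
(* The set of roots meets each omega-orbit in its first point, and it is finite
   because distinct roots have distinct orbits. *)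
- exists (~` range f); apply: meets_exceptional => //; last first.
    by move=> _ [a [ra ->]]; exists a => //; exists 0.
  have root_orbit a : ~ range f a -> omega_orbit f (same_orbit f a).
    move=> ra; rewrite -(omega_orbitE f_inj (root_omega_orbit ra))//.
      exact: root_omega_orbit.
    by exists 0.
  rewrite -(eq_finite_set (inj_card_eq (f := same_orbit f) _)).
    by apply: sub_finite_set Ofin => _ [a ra <-]; apply: root_orbit.
  move=> a b; rewrite !inE => ra rb ab; apply: (root_unique f_inj) => //.
  by rewrite ab; exists 0, 0.
move=> _ S [Sext Smin] O Om.
have [s Ss Os] := exceptional_meets f_inj Sext Om.
exists s; split=> // t [St Ot]; apply: contrapT => st.
have tS : S `\ t `<` S.
  split; first exact: subDsetl.
  by move=> /(_ t St) [_]; apply.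
(* [S] without [t] still meets every omega-orbit: where [t] was the only known
   point, the orbit is [O], which contains [s]. *)
apply: (Smin _ tS); apply: meets_exceptional => //.
  exact: sub_finite_set (subDsetl (B := _)) Sext.1.
move=> O' Om'; have [s' Ss' Os'] := exceptional_meets f_inj Sext Om'.
have [s't|s't] := pselect (s' = t); last by exists s'.
exists s; first by split.
have -> // : O' = O.
by rewrite (omega_orbitE f_inj Om Ot) -s't; apply: omega_orbitE.
Qed.
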